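(* There exists an absolute constant $c > 0$ such that the following holds. Let $\varphi$ be a function of positive integers with $\varphi(d) \to 0$ as $d \to \infty$ and $\varphi(d) \ge c\,\frac{\ln\ln d}{\ln d}$ for all $d$, and put $r(d) = \tfrac12 + \varphi(d)$. Then there exists $d_0$ such that $f_{r(d)}(d) > d+1$ for all $d \ge d_0$.
   Context: For $\Omega \subset \mathbb{R}^d$, $\operatorname{diam}\Omega = \sup_{x,y\in\Omega}|x-y|$ (Euclidean distance). $f(\Omega)$ denotes the minimum number $f$ such that $\Omega = \Omega_1\cup\dots\cup\Omega_f$ with $\operatorname{diam}\Omega_i < \operatorname{diam}\Omega$ for all $i$. $S_r^{d-1}\subset\mathbb{R}^d$ is the sphere of radius $r$ centred at the origin, and $f_r(d) = \max\{ f(\Omega) : \Omega \subset S_r^{d-1},\ \operatorname{diam}\Omega = 1\}$. *)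

(* Defs.v *)
From Stdlib Require Import Reals.
Open Scope R_scope.

(* Points of R^d are represented by functions nat -> R; only the
   coordinates 0..d-1 are relevant, and subsets of the sphere below are
   required to vanish on the other coordinates. *)
Definition point := nat -> R.

Fixpoint sqnorm (d : nat) (x : point) : R :=
  match d with
  | O => 0
  | S k => sqnorm k x + (x k) ^ 2
  end.

Definition edist (d : nat) (x y : point) : R :=
  sqrt (sqnorm d (fun i => x i - y i)).

Definition in_Rd (d : nat) (x : point) : Prop :=
  forall i : nat, (d <= i)%nat -> x i = 0.

Definition sphere (d : nat) (r : R) (x : point) : Prop :=
  in_Rd d x /\ sqnorm d x = r ^ 2.

Definition dists (d : nat) (A : point -> Prop) (t : R) : Prop :=
  exists x y, A x /\ A y /\ t = edist d x y.

Definition has_diam (d : nat) (A : point -> Prop) (D : R) : Prop :=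
  is_lub (dists d A) D.

(* diam A < D ; the empty set has diameter smaller than any positive D *)
Definition diam_lt (d : nat) (A : point -> Prop) (D : R) : Prop :=
  (forall x, ~ A x) \/ (exists D', has_diam d A D' /\ D' < D).

Definition borsuk_partition (d : nat) (Om : point -> Prop) (D : R) (n : nat) : Prop :=
  exists parts : nat -> point -> Prop,
    (forall x, Om x <-> exists i, (i < n)%nat /\ parts i x) /\
    (forall i, (i < n)%nat -> diam_lt d (parts i) D).

Definition f_is (d : nat) (Om : point -> Prop) (n : nat) : Prop :=
  exists D, has_diam d Om D /\
    borsuk_partition d Om D n /\
    (forall m, (m < n)%nat -> ~ borsuk_partition d Om D m).

Definition fr_gt (d : nat) (r : R) (n : nat) : Prop :=
  exists (Om : point -> Prop) (k : nat),
    (forall x, Om x -> sphere d r x) /\ has_diam d Om 1 /\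
    f_is d Om k /\ (n < k)%nat.

(* Main.v *)
(* The idea is to push a Frankl-Wilson configuration towards antipodality.

   Let X be the 2^(N-1) vectors of {-1,1}^N with an even number of -1's, where
   N = 2q + m and q = 2^a. Half the Hamming distance u of two points of X lies in
   [0, 2q), and C(u-1, q-1) is odd only for u = 0 and u = q. Hence if Y is a
   subset of X without a pair at distance 2q, the matrix of the C(u-1, q-1) on Y
   is nonsingular, while its rows are polynomials of degree < q in the
   coordinates; so |Y| is at most the number of subsets of [N] of size < q,
   which is about 2^N exp(-m^2/(8q)).

   Distance 2q is the normalised inner product -tau with tau = (2q-m)/(2q+m).
   A tensor power and a copy of the vector itself realise t^(2k) + b t as a new
   inner product; for b = 2k tau^(2k-1) this convex function is minimal at
   t = -tau, so diametral pairs are exactly of the above kind. If m/q = 1/(4k),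
   the minimum is -1 + O(1/k) times the squared norm, so at diameter 1 the radius
   is 1/2 + O(1/k); a constant extra coordinate then gives any larger radius.
   Everything fits in dimension about N^(2k), and with k = 2^j, q = k^4 one has
   1/k = O(ln ln d / ln d) whereas m^2/q is of order k^2, far above ln d. *)

Require Import Defs.
From Stdlib Require Import Reals Lra Lia Psatz Arith Classical.
From mathcomp Require all_boot all_algebra.
Open Scope R_scope.


(** * Parity and Hamming distance on the Boolean cube *)

Fixpoint parity (n : nat) (x : nat -> bool) : bool :=
  match n with O => false | S k => xorb (parity k x) (x k) end.

Fixpoint hamming (n : nat) (x y : nat -> bool) : nat :=
  match n with
  | O => O
  | S k => (hamming k x y + if xorb (x k) (y k) then 1 else 0)%nat
  end.

(** The number of subsets of an n-set of size strictly below q, by Pascal's rule. *)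
Fixpoint binom_sum (n q : nat) : nat :=
  match q with
  | O => 0
  | S q' => match n with
            | O => 1
            | S n' => binom_sum n' q + binom_sum n' q'
            end
  end.

(* For i < 2^n this enumerates the even half of the cube of dimension n + 1. *)
Definition even_vertex (n i : nat) : nat -> bool :=
  fun l => if (l <? n)%nat then Nat.testbit i l else parity n (Nat.testbit i).

Lemma parity_ext n x y :
  (forall l, (l < n)%nat -> x l = y l) -> parity n x = parity n y.
Proof.
  intros H; induction n as [|n IH]; simpl; [easy|].
  rewrite IH, (H n) by (intros; try apply H; lia); easy.
Qed.

Lemma hamming_odd n x y :
  Nat.odd (hamming n x y) = xorb (parity n x) (parity n y).
Proof.
  induction n as [|n IH]; simpl; [easy|].
  rewrite Nat.odd_add, IH.
  destruct (parity n x), (parity n y), (x n), (y n); easy.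
Qed.

Lemma hamming_eq0 n x y :
  hamming n x y = O -> forall l, (l < n)%nat -> x l = y l.
Proof.
  induction n as [|n IH]; simpl; intros H l Hl; [lia|].
  destruct (Nat.eq_dec l n) as [->|Hne].
  - destruct (x n), (y n); simpl in H; try easy; lia.
  - apply IH; lia.
Qed.

(** The last coordinate repeats the parity of the first n, so every vertex has even weight. *)
Lemma even_vertex_hamming n i j :
  exists u, hamming (S n) (even_vertex n i) (even_vertex n j) = (2 * u)%nat.
Proof.
  assert (E : forall k, parity n (even_vertex n k) = parity n (Nat.testbit k)).
  { intros k; apply parity_ext; intros l Hl; unfold even_vertex.
    apply Nat.ltb_lt in Hl; now rewrite Hl. }
  apply Nat.even_spec; rewrite <- Nat.negb_odd, hamming_odd; simpl.
  rewrite !E; unfold even_vertex; rewrite Nat.ltb_irrefl.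
  destruct (parity n (Nat.testbit i)), (parity n (Nat.testbit j)); easy.
Qed.

Lemma even_vertex_inj n i j : (i < 2 ^ n)%nat -> (j < 2 ^ n)%nat ->
  hamming (S n) (even_vertex n i) (even_vertex n j) = O -> i = j.
Proof.
  intros Hi Hj H; apply Nat.bits_inj; intros l.
  destruct (Nat.lt_ge_cases l n) as [Hl|Hl].
  - assert (E := hamming_eq0 _ _ _ H l ltac:(lia)).
    unfold even_vertex in E; apply Nat.ltb_lt in Hl; now rewrite Hl in E.
  - assert (B : forall k, (k < 2 ^ n)%nat -> Nat.testbit k l = false).
    { intros k Hk; rewrite <- (Nat.mod_small k (2 ^ n)) by easy.
      now apply Nat.mod_pow2_bits_high. }
    now rewrite !B.
Qed.

(* A module, because MathComp's nat notations would change the meaning of the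
   inequalities in the final statement. *)
Module FranklWilson.
Import all_boot all_algebra.
Import GRing.Theory Num.Theory.
Local Open Scope ring_scope.

(** * Linear-algebra bound for a forbidden Hamming distance *)

Lemma hammingE n x y : hamming n x y = (\sum_(l < n) (x l != y l : nat))%N.
Proof.
elim: n => [|n IH] /=; first by rewrite big_ord0.
by rewrite big_ord_recr /= -IH; case: (x n) (y n) => [] [].
Qed.

Lemma binom_sumE n q : binom_sum n q = (\sum_(i < q) 'C(n, i))%N.
Proof.
elim: n q => [|n IH] [|q] /=; rewrite ?big_ord0 //.
  by rewrite big_ord_recl /= bin0 big1 // => i _; rewrite bin0n.
rewrite !IH !big_ord_recl !bin0 plusE -addnA; congr (_ + _)%N.
by rewrite -big_split /=; apply: eq_bigr => i _; rewrite binS.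
Qed.

Lemma card_small_sets N q :
  #|[set S : {set 'I_N} | (#|S| < q)%N]| = binom_sum N q.
Proof.
rewrite binom_sumE; elim: q => [|q IH].
  by rewrite big_ord0; apply: eq_card0 => S; rewrite inE ltn0.
rewrite big_ord_recr /= -IH -[N in 'C(N, _)](card_ord N) -card_draws.
rewrite -cardsUI [X in (_ = _ + X)%N]eq_card0 ?addn0; last first.
  by move=> S; rewrite !inE; case: ltngtP.
by apply: eq_card => S; rewrite !inE ltnS leq_eqVlt orbC.
Qed.

Section Rank.
Variables (n N : nat) (s : 'I_N -> 'I_n -> rat).
Hypothesis s2 : forall l y, s l y * s l y = 1.

(** Evaluations of a square-free monomial at n points, [s l y] being coordinate l of point y. *)
Definition monomial_row (S : {set 'I_N}) : 'rV[rat]_n :=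
  \row_y \prod_(l in S) s l y.

Definition small_sets K := [set S : {set 'I_N} | (#|S| <= K)%N].

Definition monomial_mx K : 'M[rat]_(#|small_sets K|, n) :=
  \matrix_i monomial_row (enum_val i).

Lemma monomial_row_sub K (S : {set 'I_N}) :
  (#|S| <= K)%N -> (monomial_row S <= monomial_mx K)%MS.
Proof.
move=> hS; have hS' : S \in small_sets K by rewrite inE.
have -> : monomial_row S = row (enum_rank_in hS' S) (monomial_mx K).
  by rewrite rowK enum_rankK_in.
exact: row_sub.
Qed.

(** Since [s l y] squares to 1, multiplication by coordinate l either deletes l from S or adds it;
    monomials stay square-free and the degree grows by at most one. *)
Lemma monomial_mx_mul K l :
  (monomial_mx K *m diag_mx (\row_y s l y) <= monomial_mx K.+1)%MS.
Proof.
apply/row_subP => i; rewrite row_mul rowK.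
have := enum_valP i; rewrite inE; set S := enum_val i => hS.
have [lS|lS] := boolP (l \in S).
  suff -> : monomial_row S *m diag_mx (\row_y s l y) = monomial_row (S :\ l).
    by apply: monomial_row_sub; rewrite (cardsD1 l) lS in hS; apply: leq_trans (leqnSn _); apply: ltnW.
  apply/rowP => y; rewrite mul_mx_diag !mxE (big_setD1 l) //= mulrAC.
  by rewrite s2 mul1r.
suff -> : monomial_row S *m diag_mx (\row_y s l y) = monomial_row (l |: S).
  by apply: monomial_row_sub; rewrite cardsU1 lS ltnS.
by apply/rowP => y; rewrite mul_mx_diag !mxE big_setU1 //= mulrC.
Qed.

Lemma monomial_mxS K : (monomial_mx K <= monomial_mx K.+1)%MS.
Proof.
apply/row_subP => i; rewrite rowK.
by have := enum_valP i; rewrite inE => h; apply: monomial_row_sub; apply: leqW.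
Qed.

(** Induction on the number of factors: expanding the last affine factor leaves a scalar multiple
    and products with single coordinates. *)
Lemma poly_row_sub (c : nat -> rat) (a : 'I_N -> rat) K :
  (\row_y \prod_(j < K) (c j + \sum_l a l * s l y) <= monomial_mx K)%MS.
Proof.
elim: K => [|K IH].
  suff -> : \row_y \prod_(j < 0) (c j + \sum_l a l * s l y) = monomial_row set0.
    by apply: monomial_row_sub; rewrite cards0.
  by apply/rowP => y; rewrite !mxE big_ord0 big_set0.
set f := \row_y _ in IH.
have -> : \row_y \prod_(j < K.+1) (c j + \sum_l a l * s l y) =
  c K *: f + \sum_l a l *: (f *m diag_mx (\row_y s l y)).
  apply/rowP => y; rewrite !mxE big_ord_recr /= mulrDr mulrC; congr (_ + _).
  rewrite summxE mulr_sumr; apply: eq_bigr => l _.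
  by rewrite mxE mul_mx_diag !mxE mulrCA.
apply: addmx_sub; first by apply: scalemx_sub; apply: submx_trans (monomial_mxS K).
apply: summx_sub => l _; apply: scalemx_sub.
by apply: submx_trans (monomial_mx_mul K l); apply: submxMr.
Qed.

Lemma rank_poly_mx (c : nat -> rat) (a : 'I_n -> 'I_N -> rat) K :
  (\rank (\matrix_(i < n, y < n) (\prod_(j < K) (c j + \sum_l a i l * s l y))%R)
     <= binom_sum N K.+1)%N.
Proof.
apply: (@leq_trans (\rank (monomial_mx K))).
  apply: mxrankS; apply/row_subP => i.
  set G := \matrix_(_, _) _; suff -> : row i G =
    \row_y \prod_(j < K) (c j + \sum_l a i l * s l y) by apply: poly_row_sub.
  by apply/rowP => y; rewrite !mxE.
apply: leq_trans (rank_leq_row _) _.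
by rewrite -card_small_sets subset_leq_card //; apply/subsetP => S; rewrite !inE ltnS.
Qed.

End Rank.

(** With q = 2^a, q C(v, q) = (v - q + 1) C(v, q-1). An odd C(v, q-1) would make q divide v - q + 1,
    which lies strictly between 0 and q once v >= q. *)
Lemma even_bin_pow2 a v :
  (v < (2 ^ a).*2.-1)%N -> v != (2 ^ a).-1 -> ~~ odd 'C(v, (2 ^ a).-1).
Proof.
have := expn_gt0 2 a; rewrite /=; set q := (2 ^ a)%N => q0 hv hne.
have [hlt|hge] := ltnP v q.-1; first by rewrite bin_small.
have hq : (q <= v)%N by rewrite -(prednK q0) ltn_neqAle eq_sym hne.
have e := mul_bin_left v q.-1; rewrite (prednK q0) in e.
apply/negP => hodd.
have : (q %| v - q.-1)%N.
  rewrite -(@Gauss_dvdl _ _ 'C(v, q.-1)).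
    by rewrite -e dvdn_mulr.
  by rewrite /q coprimeXl // coprime2n.
have : (0 < v - q.-1 < q)%N.
  rewrite subn_gt0 (leq_trans _ hq) ?ltn_predL //= ltn_subLR; last first.
    exact: leq_trans (leq_pred _) hq.
  by move: hv; rewrite -(prednK q0) doubleS /= addnS addnn.
by case/andP => h1 h2; apply/negP; rewrite gtnNdvd.
Qed.

(* In the proof M is diagonal with entries 1 modulo 2, hence invertible over the
   rationals, and the entries of (q-1)! M are products of q-1 affine forms. *)
Lemma frankl_wilson N a n (x : 'I_n -> nat -> bool) :
  let q := (2 ^ a)%N in
  (N < 4 * q)%N ->
  (forall i j, ~~ odd (hamming N (x i) (x j))) ->
  (forall i j, hamming N (x i) (x j) = 0 -> i = j)%N ->
  (forall i j, hamming N (x i) (x j) <> q.*2) ->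
  (n <= binom_sum N q)%N.
Proof.
move=> q hN hev hinj hforb.
have q0 : (0 < q)%N by rewrite expn_gt0.
pose u i j := (hamming N (x i) (x j))./2.
have u2 i j : (u i j).*2 = hamming N (x i) (x j).
  by rewrite -[RHS]odd_double_half (negbTE (hev i j)).
have uq i j : (u i j < q.*2)%N.
  rewrite -ltn_double u2; apply: leq_ltn_trans (_ : (N < _)%N); last first.
    by rewrite -!muln2 -mulnA mulnC.
  rewrite hammingE -[X in (_ <= X)%N]card_ord -sum1_card.
  by apply: leq_sum => l _; case: (_ != _).
have u_gt0 i j : i != j -> (0 < u i j)%N.
  by move=> ne; rewrite -double_gt0 u2 lt0n; apply: contraNneq ne => /hinj ->.
have u_diag i : u i i = 0%N.
  by rewrite /u hammingE big1 // => l _; rewrite eqxx.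
have u_neq i j : u i j != q by apply/eqP => e; apply: (hforb i j); rewrite -u2 e.
(* The diagonal entry is C(-1, q-1), the value of the polynomial C(u-1, q-1) at u = 0; truncated
   subtraction would give C(0, q-1) instead. *)
pose M : 'M[int]_n :=
  \matrix_(i, j) if i == j then (-1) ^+ q.-1 else 'C((u i j).-1, q.-1)%:Z.
have Munit : map_mx (intr : int -> rat) M \in unitmx.
  rewrite unitmxE det_map_mx unitfE intr_eq0.
  apply/eqP => /(congr1 (intr : int -> 'F_2)) /eqP.
  rewrite -det_map_mx.
  suff -> : map_mx (intr : int -> 'F_2) M = 1%:M by rewrite det1 oner_eq0.
  apply/matrixP => i j; rewrite !mxE; case: (altP (i =P j)) => [_|ne].
    by rewrite rmorphXn /= rmorphN1 oppr_pchar2 ?pchar_Fp // expr1n.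
  have := @even_bin_pow2 a (u i j).-1.
  rewrite -/q => h; apply/eqP; rewrite -[_%:~R]/((_ %:R : 'F_2)) -(dvdn_pcharf (pchar_Fp (isT : prime 2))) dvdn2.
  apply: h; first by rewrite -ltnS !prednK ?double_gt0 // ?u_gt0 //; apply: uq.
  apply: contra (u_neq i j) => /eqP e; rewrite -(prednK (u_gt0 _ _ ne)) e prednK //.
pose sg i (l : 'I_N) : rat := (-1) ^+ (x i l).
have sg2 l y : sg y l * sg y l = 1 by rewrite -expr2 sqrr_sign.
(* Coordinate l contributes [(1 - sg i l * sg j l) / 4], so [u i j] is an affine form in the signs
   of point j. *)
have hu i j : (u i j)%:R = N%:R / 4%:R + \sum_l (- sg i l / 4%:R) * sg j l.
  have -> : (u i j)%:R = (hamming N (x i) (x j))%:R / 2%:R :> rat.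
    by rewrite -u2 -muln2 natrM mulfK.
  rewrite hammingE natr_sum -[in N%:R](card_ord N) -sum1_card natr_sum !mulr_suml -big_split /=.
  by apply: eq_bigr => l _; rewrite /sg; case: (x i l) (x j l) => [] [].
(* The factors u - 1, ..., u - (q-1) multiply to (q-1)! C(u-1, q-1). *)
have := @rank_poly_mx n N (fun l y => sg y l) sg2
  (fun k => N%:R / 4%:R - k.+1%:R) (fun i l => - sg i l / 4%:R) q.-1.
rewrite prednK //; apply: leq_trans.
set G := \matrix_(i, y) _.
suff -> : G = (q.-1)`!%:R *: map_mx intr M.
  by rewrite eqmx_scale ?mxrank_unit // pnatr_eq0 -lt0n fact_gt0.
apply/matrixP => i j; rewrite !mxE.
under eq_bigr => k _ do rewrite addrAC -hu.
case: (altP (i =P j)) => [->|ne].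
  rewrite u_diag rmorphXn /= rmorphN1.
  under eq_bigr => k _ do rewrite sub0r.
  by rewrite prodrN card_ord mulrC fact_prod -natr_prod big_add1 big_mkord.
rewrite -[_%:~R]/((_ %:R : rat)) -natrM mulnC bin_ffact.
have := u_gt0 i j ne; set v := u i j => v0.
elim: q.-1 => [|k IH]; first by rewrite big_ord0 ffactn0.
rewrite big_ord_recr /= IH ffactnSr natrM.
(* A factor v - 1 - k is negative only after the factor 0 has already occurred. *)
have [hk|hk] := leqP k v.-1; last by rewrite ffact_small // !mul0r.
by rewrite natrB // -[in LHS](prednK v0) -!natr1 opprD addrACA subrr addr0.
Qed.

(** * Colourings of the even half of the cube *)

Lemma pigeonhole (n m b : nat) (col : nat -> nat) :
  (m * b < n)%N -> (forall i, (i < n)%N -> (col i < m)%N) ->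
  exists c, (b < #|[set i : 'I_n | col i == c]|)%N.
Proof.
move=> hlt hcol.
have [/existsP[c hc]|/existsPn h] :=
  boolP [exists c : 'I_m, (b < #|[set i : 'I_n | col i == c]|)%N].
  by exists (nat_of_ord c).
exfalso; move: hlt; rewrite ltnNge => /negP; apply.
rewrite -[X in (X <= _)%N]card_ord -sum1_card.
rewrite (partition_big (fun i : 'I_n => Ordinal (hcol i (ltn_ord i))) predT) //=.
rewrite -[m in (_ <= m * _)%N]card_ord -sum_nat_const; apply: leq_sum => c _.
rewrite sum1dep_card leqNgt; have := h c; congr (~~ (_ < _)%N); apply: eq_card => i.
Qed.

Lemma expnE m n : Nat.pow m n = expn m n.
Proof. by elim: n => [|n IH] //=; rewrite IH expnS. Qed.

(** Some colour class has more than [binom_sum (S n) (2 ^ a)] vertices, too many to avoid the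
    distance 2 * 2^a. *)
Lemma monochromatic_pair a n m (col : nat -> nat) :
  (S n < 4 * Nat.pow 2 a)%coq_nat ->
  (m * binom_sum (S n) (Nat.pow 2 a) < Nat.pow 2 n)%coq_nat ->
  (forall i, (i < Nat.pow 2 n)%coq_nat -> (col i < m)%coq_nat) ->
  exists i j, [/\ (i < Nat.pow 2 n)%coq_nat, (j < Nat.pow 2 n)%coq_nat, col i = col j
    & hamming (S n) (even_vertex n i) (even_vertex n j) = (2 * Nat.pow 2 a)%coq_nat].
Proof.
move=> /ltP hn /ltP hlt hcol.
have [c hc] := pigeonhole _ _ _ _ hlt (fun i hi => introT ltP (hcol i (elimT ltP hi))).
set A := [set i : 'I_(Nat.pow 2 n) | col i == c] in hc.
pose v (k : 'I_#|A|) := nat_of_ord (enum_val k).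
have hv k : (v k < Nat.pow 2 n)%coq_nat by apply/ltP/ltn_ord.
have hcv k : col (v k) = c by have := enum_valP k; rewrite inE => /eqP.
have [/existsP[i /existsP[j /eqP hij]]|/existsPn h] := boolP [exists i, exists j,
  hamming (S n) (even_vertex n (v i)) (even_vertex n (v j)) == (2 * Nat.pow 2 a)%coq_nat].
  by exists (v i), (v j); split; rewrite ?hcv.
suff : (#|A| <= binom_sum n.+1 (Nat.pow 2 a))%N by rewrite leqNgt hc.
rewrite (expnE 2 a); apply: (@frankl_wilson _ a _ (fun k => even_vertex n (v k))).
- by rewrite -expnE; exact: hn.
- by move=> i j; have [u ->] := even_vertex_hamming n (v i) (v j); rewrite multE mul2n odd_double.
- by move=> i j /even_vertex_inj e; apply/enum_val_inj/val_inj/e; apply/ltP/ltn_ord.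
- move=> i j e; have /existsPn/(_ j)/eqP := h i; apply.
  by rewrite e -expnE multE mul2n.
Qed.

End FranklWilson.


Lemma monochromatic_pair a n m (col : nat -> nat) :
  (S n < 4 * 2 ^ a)%nat ->
  (m * binom_sum (S n) (2 ^ a) < 2 ^ n)%nat ->
  (forall i, (i < 2 ^ n)%nat -> (col i < m)%nat) ->
  exists i j, (i < 2 ^ n)%nat /\ (j < 2 ^ n)%nat /\ col i = col j /\
    hamming (S n) (even_vertex n i) (even_vertex n j) = (2 * 2 ^ a)%nat.
Proof.
  intros Hn Hm Hcol.
  destruct (FranklWilson.monochromatic_pair a n m col Hn Hm Hcol)
    as [i [j [Hi Hj Hc Hh]]].
  exists i, j; auto.
Qed.

(** * Inner products of tensor powers *)

Fixpoint sumR (n : nat) (f : nat -> R) : R :=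
  match n with O => 0 | S k => sumR k f + f k end.

Lemma sumR_ext n f g :
  (forall i, (i < n)%nat -> f i = g i) -> sumR n f = sumR n g.
Proof.
  intros H; induction n as [|n IH]; simpl; [easy|].
  rewrite IH, (H n) by (intros; try apply H; lia); easy.
Qed.

Lemma sumR_add a b f : sumR (a + b) f = sumR a f + sumR b (fun i => f (a + i)%nat).
Proof.
  induction b as [|b IH]; rewrite ?Nat.add_0_r, ?Nat.add_succ_r; simpl; lra.
Qed.

Lemma sumR_zero n f : (forall i, (i < n)%nat -> f i = 0) -> sumR n f = 0.
Proof.
  intros H; induction n as [|n IH]; simpl; [easy|].
  rewrite IH, (H n) by (intros; try apply H; lia); lra.
Qed.

Lemma sumR_scal n c f : sumR n (fun i => c * f i) = c * sumR n f.
Proof. induction n as [|n IH]; simpl; [ring|rewrite IH; ring]. Qed.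

(** The index i stands for the pair (i / N, i mod N), as in a tensor product. *)
Lemma sumR_prod M N (F G : nat -> R) : (0 < N)%nat ->
  sumR (M * N) (fun i => F (i mod N)%nat * G (i / N)%nat) = sumR N F * sumR M G.
Proof.
  intros HN; induction M as [|M IH]; [simpl; ring|].
  replace (S M * N)%nat with (M * N + N)%nat by lia.
  rewrite sumR_add, IH; cbn [sumR].
  rewrite (sumR_ext N (fun i => F ((M * N + i) mod N)%nat * G ((M * N + i) / N)%nat)
    (fun i => G M * F i)).
  - rewrite sumR_scal; ring.
  - intros i Hi; rewrite Nat.add_comm, Nat.Div0.mod_add, Nat.mod_small,
      Nat.div_add, Nat.div_small by lia; simpl; ring.
Qed.

Lemma sqnorm_sumR d x : sqnorm d x = sumR d (fun i => x i * x i).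
Proof. induction d as [|d IH]; simpl; [easy|rewrite IH; ring]. Qed.

Lemma sqnorm_sub d x y :
  sqnorm d (fun i => x i - y i) =
  sqnorm d x + sqnorm d y - 2 * sumR d (fun i => x i * y i).
Proof. induction d as [|d IH]; simpl; [ring|rewrite IH; ring]. Qed.

Definition spin (x : nat -> bool) (l : nat) : R := if x l then -1 else 1.

Lemma sumR_spin N x y :
  sumR N (fun l => spin x l * spin y l) = INR N - 2 * INR (hamming N x y).
Proof.
  induction N as [|N IH]; [simpl; ring|].
  cbn [sumR hamming]; rewrite IH, plus_INR, S_INR; unfold spin.
  destruct (x N), (y N); simpl; ring.
Qed.

(** The base-N digits of i are the p indices of the tensor entry. *)
Fixpoint tensor (N p : nat) (x : nat -> bool) (i : nat) : R :=
  match p with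
  | O => 1
  | S p' => spin x (i mod N) * tensor N p' x (i / N)
  end.

Lemma sumR_tensor N p x y : (0 < N)%nat ->
  sumR (N ^ p) (fun i => tensor N p x i * tensor N p y i) =
  (INR N - 2 * INR (hamming N x y)) ^ p.
Proof.
  intros HN; induction p as [|p IH]; [simpl; ring|].
  rewrite Nat.pow_succ_r', Nat.mul_comm; cbn [tensor pow].
  set (F := fun l => spin x l * spin y l).
  set (G := fun l => tensor N p x l * tensor N p y l) in *.
  rewrite (sumR_ext _ _ (fun i => F (i mod N)%nat * G (i / N)%nat))
    by (intros; unfold F, G; ring).
  rewrite sumR_prod, IH by easy; unfold F; rewrite sumR_spin; easy.
Qed.

(** The constant [ga] raises the radius without changing distances; the zeros after it keep the
    point in R^d. *)
Definition embed (N p : nat) (al be ga : R) (x : nat -> bool) : point :=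
  fun i =>
    if (i <? N ^ p)%nat then al * tensor N p x i
    else if (i <? N ^ p + N)%nat then be * spin x (i - N ^ p)
    else if (i =? N ^ p + N)%nat then ga else 0.

Lemma sumR_embed N p al be ga x y d : (0 < N)%nat -> (N ^ p + N + 1 <= d)%nat ->
  let s := INR N - 2 * INR (hamming N x y) in
  sumR d (fun i => embed N p al be ga x i * embed N p al be ga y i) =
  al ^ 2 * s ^ p + be ^ 2 * s + ga ^ 2.
Proof.
  intros HN Hd s.
  replace d with (N ^ p + (N + (1 + (d - (N ^ p + N + 1)))))%nat by lia.
  rewrite !sumR_add.
  rewrite (sumR_ext (N ^ p) _ (fun i => al ^ 2 * (tensor N p x i * tensor N p y i))).
  2: { intros i Hi; unfold embed; apply Nat.ltb_lt in Hi; rewrite Hi; ring. }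
  rewrite (sumR_ext N _ (fun i => be ^ 2 * (spin x i * spin y i))).
  2: { intros i Hi; unfold embed.
       rewrite (proj2 (Nat.ltb_ge _ _)), (proj2 (Nat.ltb_lt _ _)) by lia.
       replace (N ^ p + i - N ^ p)%nat with i by lia; ring. }
  rewrite (sumR_ext 1 _ (fun i => ga ^ 2)).
  2: { intros i Hi; unfold embed.
       rewrite (proj2 (Nat.ltb_ge _ _)), (proj2 (Nat.ltb_ge _ _)),
         (proj2 (Nat.eqb_eq _ _)) by lia; ring. }
  rewrite (sumR_zero (d - _)).
  2: { intros i Hi; unfold embed.
       rewrite (proj2 (Nat.ltb_ge _ _)), (proj2 (Nat.ltb_ge _ _)),
         (proj2 (Nat.eqb_neq _ _)) by lia; ring. }
  rewrite !sumR_scal, sumR_tensor, sumR_spin by easy; fold s; simpl; ring.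
Qed.

(** * Minimum of the new inner product *)

(** The power s^(L+1) lies above its tangent at tau: the difference for L + 1 is s times the one for
    L plus (L+1) tau^L (s - tau)^2. *)
Lemma pow_tangent tau s L : 0 < tau -> 0 <= s ->
  0 <= s ^ S L - INR (S L) * tau ^ L * s + INR L * tau ^ S L.
Proof.
  intros Ht Hs; induction L as [|L IH]; [simpl; lra|].
  assert (H1 : 0 <= s * (s ^ S L - INR (S L) * tau ^ L * s + INR L * tau ^ S L))
    by (apply Rmult_le_pos; easy).
  assert (H2 : 0 <= (INR L + 1) * tau ^ L * (s - tau) ^ 2).
  { apply Rmult_le_pos; [|apply pow2_ge_0].
    apply Rmult_le_pos; [pose proof (pos_INR L); lra|apply pow_le; lra]. }
  rewrite !S_INR in *; simpl in *; nra.
Qed.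

(* The bound is the value at t = -tau, the critical point of this convex function. *)
Lemma even_poly_min tau t k : 0 < tau ->
  let L := S (2 * k) in
  - (INR L * tau ^ S L) <= t ^ S L + INR (S L) * tau ^ L * t.
Proof.
  intros Ht L.
  assert (HP : 0 < tau ^ L) by (apply pow_lt; easy).
  pose proof (pos_INR L).
  assert (HE : forall u, (- u) ^ S L = u ^ S L).
  { intros u; replace (S L) with (2 * S k)%nat by (unfold L; lia).
    rewrite !pow_mult; f_equal; ring. }
  (* For t <= 0 the tangent inequality applies at -t, the exponent being even; for t > 0 the two
     sides have opposite signs. *)
  destruct (Rle_lt_dec t 0) as [Hneg|Hpos].
  - pose proof (pow_tangent tau (- t) L Ht ltac:(lra)) as HT.
    rewrite HE in HT; lra.
  - assert (0 < t ^ S L) by (apply pow_lt; easy).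
    assert (0 < tau ^ S L) by (apply pow_lt; easy).
    rewrite S_INR.
    assert (0 <= (INR L + 1) * tau ^ L * t) by 
      (apply Rmult_le_pos; [apply Rmult_le_pos|]; lra).
    assert (0 <= INR L * tau ^ S L) by (apply Rmult_le_pos; lra).
    lra.
Qed.

(** * From parameters to a set on the sphere *)

Lemma finite_choice n (P : nat -> nat -> Prop) :
  (forall i, (i < n)%nat -> exists c, P i c) ->
  exists f : nat -> nat, forall i, (i < n)%nat -> P i (f i).
Proof.
  intros H; induction n as [|n IH]; [exists (fun _ => O); lia|].
  destruct IH as [f Hf]; [intros; apply H; lia|].
  destruct (H n ltac:(lia)) as [c Hc].
  exists (fun i => if (i =? n)%nat then c else f i); intros i Hi.
  destruct (Nat.eqb_spec i n) as [->|Hne]; [easy|apply Hf; lia].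
Qed.

Lemma least_nat (P : nat -> Prop) n :
  P n -> exists k, P k /\ forall m, (m < k)%nat -> ~ P m.
Proof.
  induction n as [n IH] using lt_wf_ind; intros Hn.
  destruct (classic (exists m, (m < n)%nat /\ P m)) as [[m [Hm HP]]|HN].
  - apply (IH m Hm HP).
  - exists n; split; [easy|]; intros m Hm HP; apply HN; eauto.
Qed.

(** The equation for [tau] says that Hamming distance 2 * 2^a means inner product -tau N. The last
    hypothesis bounds from below by the squared radius that the set has at diameter 1 without the
    constant coordinate. *)
Lemma fr_gt_of_parameters a n k d (r tau : R) :
  let N := S n in
  let L := S (2 * k) in
  let b := INR (S L) * tau ^ L in
  (N < 4 * 2 ^ a)%nat ->
  ((d + 1) * binom_sum N (2 ^ a) < 2 ^ n)%nat ->
  (N ^ S L + N + 1 <= d)%nat ->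
  tau * INR N = 4 * INR (2 ^ a) - INR N ->
  (1 + b) / (2 * (1 + b + INR L * tau ^ S L)) <= r ^ 2 ->
  fr_gt d r (d + 1).
Proof.
  intros N L b Hq Hcol Hd Htau Hr.
  (* The scaling that gives diametral pairs, those with t = -tau, distance 1. *)
  set (A := / (2 * (1 + b + INR L * tau ^ S L))).
  assert (HN0 : 0 < INR N) by (apply lt_0_INR; unfold N; lia).
  assert (Ht : 0 < tau).
  { apply lt_INR in Hq; rewrite mult_INR in Hq; simpl (INR 4) in Hq.
    apply (Rmult_lt_reg_r (INR N)); [easy|lra]. }
  assert (HL : 0 < INR L) by (apply lt_0_INR; unfold L; lia).
  assert (Hb : 0 < b).
  { unfold b; apply Rmult_lt_0_compat; [apply lt_0_INR; lia|apply pow_lt; easy]. }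
  assert (HLt : 0 < INR L * tau ^ S L)
    by (apply Rmult_lt_0_compat; [easy|apply pow_lt; easy]).
  assert (HA : 0 < A) by (apply Rinv_0_lt_compat; lra).
  assert (HA1 : 2 * A * (1 + b + INR L * tau ^ S L) = 1) by (unfold A; field; lra).
  change ((1 + b) * A <= r ^ 2) in Hr.
  assert (HNp : 0 < INR N ^ S L) by (apply pow_lt; easy).
  (* Dividing by powers of N turns inner products into t, with t = 1 for a point and itself; [ga]
     then fills the squared norm up to r^2. *)
  set (al := sqrt (A / INR N ^ S L)).
  set (be := sqrt (A * b / INR N)).
  set (ga := sqrt (r ^ 2 - (1 + b) * A)).
  assert (Hal : al ^ 2 = A / INR N ^ S L).
  { apply pow2_sqrt; left; apply Rdiv_lt_0_compat; easy. }
  assert (Hbe : be ^ 2 = A * b / INR N).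
  { apply pow2_sqrt; left; apply Rdiv_lt_0_compat; [|easy].
    apply Rmult_lt_0_compat; easy. }
  assert (Hga : ga ^ 2 = r ^ 2 - (1 + b) * A) by (apply pow2_sqrt; lra).
  set (P := fun i => embed N (S L) al be ga (even_vertex n i)).
  set (h := fun i j => hamming N (even_vertex n i) (even_vertex n j)).
  assert (Hdot : forall i j, sumR d (fun l => P i l * P j l) =
    let t := 1 - 2 * INR (h i j) / INR N in
    A * (t ^ S L + b * t) + (r ^ 2 - (1 + b) * A)).
  { intros i j; set (t := 1 - 2 * INR (h i j) / INR N); cbv zeta; unfold P; rewrite sumR_embed by (try exact Hd; unfold N; lia).
    fold (h i j).
    replace (INR N - 2 * INR (h i j)) with (INR N * t) by (unfold t; field; lra).
    rewrite Hal, Hbe, Hga, Rpow_mult_distr; field; lra. }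
  assert (Hhii : forall i, h i i = O).
  { intros i; unfold h; generalize N as M; induction M as [|M IH]; simpl; [easy|].
    rewrite IH; destruct (even_vertex n i M); easy. }
  assert (Hsq : forall i, sqnorm d (P i) = r ^ 2).
  { intros i; rewrite sqnorm_sumR, Hdot, Hhii; cbv zeta.
    replace (1 - 2 * INR 0 / INR N) with 1 by (change (INR 0) with 0; field; lra).
    rewrite pow1; ring. }
  assert (Hd2 : forall i j, sqnorm d (fun l => P i l - P j l) =
    let t := 1 - 2 * INR (h i j) / INR N in
    2 * A * (1 + b - (t ^ S L + b * t))).
  { intros i j; rewrite sqnorm_sub, !Hsq, Hdot; cbv zeta; ring. }
  assert (Hle : forall i j, edist d (P i) (P j) <= 1).
  { intros i j; unfold edist; rewrite <- sqrt_1; apply sqrt_le_1_alt.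
    rewrite Hd2; cbv zeta.
    pose proof (even_poly_min tau (1 - 2 * INR (h i j) / INR N) k Ht) as HM.
    cbv zeta in HM; fold L in HM; fold b in HM.
    apply Rle_trans with (2 := Req_le _ _ HA1); apply Rmult_le_compat_l; lra. }
  assert (Heq : forall i j, h i j = (2 * 2 ^ a)%nat -> edist d (P i) (P j) = 1).
  { intros i j Hh; unfold edist; rewrite <- sqrt_1; f_equal.
    rewrite Hd2, Hh, mult_INR; cbv zeta; change (INR 2) with 2.
    replace (1 - 2 * (2 * INR (2 ^ a)) / INR N) with (- tau).
    2: { apply (Rmult_eq_reg_r (INR N)); [|lra].
         replace ((1 - 2 * (2 * INR (2 ^ a)) / INR N) * INR N)
           with (INR N - 4 * INR (2 ^ a)) by (field; lra).
         lra. }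
    replace ((- tau) ^ S L) with (tau ^ S L).
    2: { replace (S L) with (2 * S k)%nat by (unfold L; lia).
         rewrite !pow_mult; f_equal; ring. }
    transitivity (2 * A * (1 + b + INR L * tau ^ S L)); [|exact HA1].
    unfold b; rewrite (S_INR L); change (tau ^ S L) with (tau * tau ^ L); ring. }
  set (Om := fun z : point => exists i, (i < 2 ^ n)%nat /\ z = P i).
  assert (HOm : has_diam d Om 1).
  { split.
    - intros t [x [y [[i [_ ->]] [[j [_ ->]] ->]]]]; apply Hle.
    - intros D HD.
      (* A single colour already yields a diametral pair, so the diameter 1 is attained. *)
      destruct (monochromatic_pair a n 1 (fun _ => O)) as [i [j [Hi [Hj [_ Hh]]]]];
        [easy| |lia|].
      { unfold N in Hcol; nia. }
      apply HD; exists (P i), (P j).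
      repeat split; [now exists i|now exists j|now rewrite Heq]. }
  assert (Hno : forall m, (m <= d + 1)%nat -> ~ borsuk_partition d Om 1 m).
  { intros m Hm [parts [Hcov Hdiam]].
    destruct (finite_choice (2 ^ n) (fun i c => (c < m)%nat /\ parts c (P i)))
      as [f Hf].
    { intros i Hi; apply Hcov; now exists i. }
    (* Parts act as colours; a part holding a diametral pair has diameter at least 1. *)
    destruct (monochromatic_pair a n m f) as [i [j [Hi [Hj [Hc Hh]]]]].
    - easy.
    - apply Nat.le_lt_trans with (2 := Hcol); apply Nat.mul_le_mono_r; easy.
    - intros i Hi; apply Hf; easy.
    - destruct (Hf i Hi) as [Hm1 Hp1], (Hf j Hj) as [_ Hp2].
      rewrite <- Hc in Hp2.
      destruct (Hdiam (f i) Hm1) as [He|[D' [[HU _] HD']]]; [now apply (He (P i))|].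
      assert (1 <= D') by (apply HU; exists (P i), (P j); now rewrite Heq).
      lra. }
  (* The partition into 2^n singletons guarantees that a minimum exists. *)
  destruct (least_nat (borsuk_partition d Om 1) (2 ^ n)) as [K [HK HKmin]].
  { exists (fun i z => z = P i); split; [easy|].
    intros i Hi; right; exists 0; split; [|lra].
    assert (E0 : edist d (P i) (P i) = 0).
    { unfold edist; rewrite sqnorm_sub, sqnorm_sumR.
      rewrite <- sqrt_0; f_equal; ring. }
    split.
    - intros t [x [y [-> [-> ->]]]]; rewrite E0; lra.
    - intros D HD; apply HD; exists (P i), (P i); now rewrite E0. }
  exists Om, K; split; [|split; [easy|split]].
  - intros x [i [_ ->]]; split; [|apply Hsq].
    intros l Hl; unfold P, embed.
    rewrite (proj2 (Nat.ltb_ge _ _)), (proj2 (Nat.ltb_ge _ _)),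
         (proj2 (Nat.eqb_neq _ _)) by lia; easy.
  - now exists 1.
  - destruct (Nat.lt_ge_cases (d + 1) K) as [|HKd]; [easy|].
    now elim (Hno K HKd).
Qed.


(** * Binomial tail and radius estimates *)

(** As z <= 1, each term C(n, i) z^i with i < q is at least C(n, i) z^q; the induction follows
    Pascal's rule. *)
Lemma binom_sum_chernoff n q z : 0 < z <= 1 ->
  INR (binom_sum n q) * z ^ q <= (1 + z) ^ n.
Proof.
  intros Hz; revert q; induction n as [|n IH]; intros [|q].
  - simpl; lra.
  - assert (z ^ S q <= 1) by (rewrite <- (pow1 (S q)); apply pow_incr; lra).
    simpl binom_sum; simpl INR; simpl ((1 + z) ^ 0); lra.
  - simpl INR; rewrite Rmult_0_l; apply pow_le; lra.
  - cbn [binom_sum]; rewrite plus_INR.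
    pose proof (IH (S q)); pose proof (IH q).
    assert (z * (INR (binom_sum n q) * z ^ q) <= z * (1 + z) ^ n)
      by (apply Rmult_le_compat_l; lra).
    simpl in *; lra.
Qed.

Lemma exp_pow x n : exp x ^ n = exp (INR n * x).
Proof.
  induction n as [|n IH]; [simpl; rewrite Rmult_0_l, exp_0; easy|].
  rewrite S_INR, Rmult_plus_distr_r, exp_plus, <- IH, Rmult_1_l; simpl; ring.
Qed.

(** The previous bound at z = 1 - eta. The choice eta = m/(2q) minimises the exponent, to
    -m^2/(8q). *)
Lemma binom_sum_tail q m eta : 0 < eta <= 1 / 2 ->
  INR (binom_sum (2 * q + m) q) <=
  2 ^ (2 * q + m) * exp (INR q * (eta ^ 2 / 2) - INR m * (eta / 2)).
Proof.
  intros He.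
  pose proof (binom_sum_chernoff (2 * q + m) q (1 - eta) ltac:(lra)) as HC.
  assert (Hp : 0 < (1 - eta) ^ q) by (apply pow_lt; lra).
  apply (Rmult_le_reg_r ((1 - eta) ^ q)); [easy|].
  apply Rle_trans with (1 := HC).
  replace (1 + (1 - eta)) with (2 * (1 - eta / 2)) by field.
  rewrite Rpow_mult_distr, Rmult_assoc.
  apply Rmult_le_compat_l; [apply pow_le; lra|].
  rewrite pow_add, pow_mult.
  unfold Rminus at 3; rewrite exp_plus.
  replace (- (INR m * (eta / 2))) with (INR m * (- (eta / 2))) by ring.
  rewrite <- !exp_pow.
  replace (exp (eta ^ 2 / 2) ^ q * exp (- (eta / 2)) ^ m * (1 - eta) ^ q)
    with ((exp (eta ^ 2 / 2) * (1 - eta)) ^ q * exp (- (eta / 2)) ^ m)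
    by (rewrite Rpow_mult_distr; ring).
  apply Rmult_le_compat; [apply pow_le, pow2_ge_0|apply pow_le; lra| |].
  - apply pow_incr; split; [apply pow2_ge_0|].
    pose proof (exp_ineq1_le (eta ^ 2 / 2)).
    (* The inequality (1 - eta/2)^2 <= (1 + eta^2/2)(1 - eta) uses eta <= 1/2. *)
    apply Rle_trans with ((1 + eta ^ 2 / 2) * (1 - eta)); [nra|].
    apply Rmult_le_compat_r; lra.
  - apply pow_incr; split; [lra|].
    pose proof (exp_ineq1_le (- (eta / 2))); lra.
Qed.

Lemma bernoulli e n : 0 <= e <= 1 -> 1 - INR n * e <= (1 - e) ^ n.
Proof.
  intros He; induction n as [|n IH]; [simpl; lra|].
  rewrite S_INR; cbn [pow]; pose proof (pos_INR n).
  apply Rle_trans with ((1 - e) * (1 - INR n * e)); [nra|].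
  apply Rmult_le_compat_l; lra.
Qed.

(** Here 1 - e is tau. The powers U = tau^(2k-1) and T = tau^(2k) differ by e U <= 1/(4k), and T >=
    1/2 by Bernoulli, so the quotient is 1/4 + O(1/k). *)
Lemma radius_bound (k : nat) e : (1 <= k)%nat ->
  0 <= e -> 4 * INR k * e <= 1 ->
  let L := S (2 * (k - 1)) in
  let b := INR (S L) * (1 - e) ^ L in
  (1 + b) / (2 * (1 + b + INR L * (1 - e) ^ S L)) <= 1 / 4 + 1 / (2 * INR k).
Proof.
  intros Hk He Hke L b.
  assert (HK : 1 <= INR k) by (now apply (le_INR 1)).
  assert (HL1 : INR (S L) = 2 * INR k).
  { change 2 with (INR 2); rewrite <- mult_INR; f_equal; unfold L; lia. }
  assert (HL0 : INR L = 2 * INR k - 1) by (pose proof (S_INR L); lra).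
  assert (He1 : e <= 1 / 4) by nra.
  assert (HT : 1 / 2 <= (1 - e) ^ S L).
  { pose proof (bernoulli e (S L) ltac:(lra)); rewrite HL1 in *; lra. }
  assert (HS : (1 - e) ^ L <= 1).
  { apply Rle_trans with (1 ^ L); [apply pow_incr; lra|rewrite pow1; lra]. }
  assert (HTS : (1 - e) ^ S L = (1 - e) * (1 - e) ^ L) by easy.
  unfold b; rewrite HL1, HL0.
  set (K := INR k) in *; set (T := (1 - e) ^ S L) in *; set (U := (1 - e) ^ L) in *.
  assert (HUT : 4 * (K * U) <= 4 * (K * T) + 1) by nra.
  assert (HTU : T <= U) by nra.
  assert (HKT : T <= K * T) by nra.
  apply (Rmult_le_reg_r (4 * K * (1 + 2 * K * U + (2 * K - 1) * T))); [nra|].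
  replace ((1 + 2 * K * U) / (2 * (1 + 2 * K * U + (2 * K - 1) * T)) *
    (4 * K * (1 + 2 * K * U + (2 * K - 1) * T)))
    with (2 * K * (1 + 2 * K * U)) by (field; nra).
  replace ((1 / 4 + 1 / (2 * K)) * (4 * K * (1 + 2 * K * U + (2 * K - 1) * T)))
    with ((K + 2) * (1 + 2 * K * U + (2 * K - 1) * T)) by (field; lra).
  nra.
Qed.

(* With q = 2^(4j), m = 2^(3j-2) and k = 2^j, the configuration fits in dimension
   2^(scale j); it serves all d below 2^(scale (j+1)). *)
Definition scale (j : nat) : nat := ((4 * j + 3) * 2 ^ (j + 1))%nat.

(** * Inequalities at a scale serving a given dimension *)

Lemma pow2_gt n : (n < 2 ^ n)%nat.
Proof. apply Nat.pow_gt_lin_r; lia. Qed.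

Lemma scale_gt j : (2 ^ j <= scale j)%nat.
Proof. unfold scale; rewrite Nat.add_1_r, Nat.pow_succ_r'; nia. Qed.

Lemma scale_between j0 d : (2 ^ scale j0 <= d)%nat ->
  exists j, (j0 <= j)%nat /\ (2 ^ scale j <= d)%nat /\ (d < 2 ^ scale (S j))%nat.
Proof.
  intros Hd.
  assert (H : forall t, (d < 2 ^ scale (j0 + t))%nat ->
    exists j, (j0 <= j)%nat /\ (2 ^ scale j <= d)%nat /\ (d < 2 ^ scale (S j))%nat).
  { induction t as [|t IH]; intros Ht; [rewrite Nat.add_0_r in Ht; lia|].
    destruct (Nat.lt_ge_cases d (2 ^ scale (j0 + t))) as [Hlt|Hge]; [auto|].
    exists (j0 + t)%nat; rewrite Nat.add_succ_r in Ht; split; [lia|easy]. }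
  apply (H d).
  pose proof (pow2_gt (scale (j0 + d))); pose proof (scale_gt (j0 + d)).
  pose proof (pow2_gt (j0 + d)); lia.
Qed.

(** The right side is the tail exponent m^2/(8q), and [scale (S j)] is (16 j + 28) 2^j. The
    threshold 16 is the least j with 16 j + 29 <= 2^(j-7). *)
Lemma scale_S_bound j : (16 <= j)%nat -> (scale (S j) + 2 <= 2 ^ (2 * j - 7))%nat.
Proof.
  intros Hj.
  assert (H : (16 * j + 29 <= 2 ^ (j - 7))%nat).
  { replace j with (16 + (j - 16))%nat by lia; generalize (j - 16)%nat as i.
    induction i as [|i IH]; [simpl; lia|].
    replace (16 + S i - 7)%nat with (S (16 + i - 7)) by lia.
    rewrite Nat.pow_succ_r'; lia. }
  replace (2 * j - 7)%nat with (j + (j - 7))%nat by lia.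
  unfold scale; replace (S j + 1)%nat with (j + 2)%nat by lia.
  rewrite !Nat.pow_add_r; change (2 ^ 2)%nat with 4%nat.
  pose proof (pow2_gt j) as Hp; revert H Hp.
  generalize (2 ^ j)%nat as X, (2 ^ (j - 7))%nat as Y; intros X Y HY HX; nia.
Qed.

Lemma exp_ge_pow2 n : 2 ^ n <= exp (INR n).
Proof.
  rewrite <- (Rmult_1_r (INR n)), <- exp_pow; apply pow_incr.
  pose proof (exp_ineq1_le 1); lra.
Qed.

Lemma coloring_bound j d : (16 <= j)%nat -> (d < 2 ^ scale (S j))%nat ->
  let q := (2 ^ (4 * j))%nat in
  let m := (2 ^ (3 * j - 2))%nat in
  ((d + 1) * binom_sum (2 * q + m) q < 2 ^ (2 * q + m - 1))%nat.
Proof.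
  intros Hj Hd q m.
  set (e := 2 ^ j).
  assert (He : 2 <= e) by (unfold e; rewrite <- (pow_1 2) at 1; apply Rle_pow; [lra|lia]).
  assert (HqR : INR q = e ^ 4).
  { unfold q, e; rewrite pow_INR, Nat.mul_comm, pow_mult; easy. }
  assert (HmR : 4 * INR m = e ^ 3).
  { unfold m, e; rewrite pow_INR, <- pow_mult; simpl (INR 2).
    replace (1 + 1) with 2 by ring.
    replace (j * 3)%nat with (2 + (3 * j - 2))%nat by lia.
    rewrite pow_add; ring. }
  (* The optimal m/(2q); the exponent becomes -m^2/(8q) = -2^(2j-7). *)
  set (eta := / (8 * e)).
  assert (Heta : 0 < eta <= 1 / 2).
  { unfold eta; split; [apply Rinv_0_lt_compat; lra|].
    replace (1 / 2) with (/ 2) by field; apply Rinv_le_contravar; lra. }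
  pose proof (binom_sum_tail q m eta Heta) as HT.
  set (K := (2 ^ (2 * j - 7))%nat).
  assert (HK : 128 * INR K = e ^ 2).
  { unfold K, e; rewrite pow_INR, <- pow_mult; simpl (INR 2).
    replace (1 + 1) with 2 by ring.
    replace (j * 2)%nat with (7 + (2 * j - 7))%nat by lia.
    rewrite pow_add; ring. }
  replace (INR q * (eta ^ 2 / 2) - INR m * (eta / 2)) with (- INR K) in HT.
  2: { replace (INR K) with (e ^ 2 / 128) by lra.
       replace (INR m) with (e ^ 3 / 4) by lra.
       rewrite HqR; unfold eta; field; lra. }
  pose proof (exp_ge_pow2 K) as HX.
  (* The factor 2 pays for having only half of the cube. *)
  assert (HdK : 2 * (INR d + 1) < 2 ^ K).
  { pose proof (scale_S_bound j Hj) as HS; fold K in HS.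
    apply lt_INR in Hd; rewrite pow_INR in Hd; simpl (INR 2) in Hd.
    replace (1 + 1) with 2 in Hd by ring.
    assert (H1 : 1 <= 2 ^ scale (S j)) by (apply pow_R1_Rle; lra).
    apply Rlt_le_trans with (2 ^ (2 + scale (S j))).
    - rewrite pow_add; lra.
    - apply Rle_pow; [lra|lia]. }
  set (B := binom_sum (2 * q + m) q) in *.
  set (M := (2 * q + m)%nat) in *.
  assert (HM : (1 <= M)%nat).
  { unfold M, m; pose proof (pow2_gt (3 * j - 2)); lia. }
  apply INR_lt; rewrite mult_INR, plus_INR, pow_INR; simpl (INR 1); simpl (INR 2).
  replace (1 + 1) with 2 by ring.
  apply (Rmult_lt_reg_l 2); [lra|].
  replace (2 * 2 ^ (M - 1)) with (2 ^ M)
    by (replace M with (S (M - 1)) at 1 by lia; easy).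
  assert (HP : 0 < 2 ^ M) by (apply pow_lt; lra).
  rewrite exp_Ropp in HT.
  assert (HE : 0 < exp (INR K)) by apply exp_pos.
  assert (HT2 : INR B * exp (INR K) <= 2 ^ M).
  { apply (Rmult_le_compat_r (exp (INR K))) in HT; [|lra].
    rewrite Rmult_assoc, Rinv_l, Rmult_1_r in HT by lra; easy. }
  pose proof (pos_INR B); pose proof (pos_INR d).
  destruct (Req_dec (INR B) 0) as [HB|HB]; [rewrite HB; lra|].
  apply Rlt_le_trans with (2 := HT2).
  replace (2 * ((INR d + 1) * INR B)) with (INR B * (2 * (INR d + 1))) by ring.
  apply Rmult_lt_compat_l; lra.
Qed.

(** N needs at most 4j + 2 bits, and one more bit absorbs N + 1; hence the factor 4j + 3 in
    [scale]. *)
Lemma dimension_bound j : (1 <= j)%nat ->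
  let N := (2 * 2 ^ (4 * j) + 2 ^ (3 * j - 2))%nat in
  (N ^ (2 * 2 ^ j) + N + 1 <= 2 ^ scale j)%nat.
Proof.
  intros Hj N.
  assert (HN : (N <= 2 ^ (4 * j + 2))%nat).
  { unfold N; rewrite Nat.pow_add_r; change (2 ^ 2)%nat with 4%nat.
    assert (2 ^ (3 * j - 2) <= 2 ^ (4 * j))%nat by (apply Nat.pow_le_mono_r; lia).
    lia. }
  assert (HN2 : (2 <= N)%nat).
  { unfold N; pose proof (pow2_gt (4 * j)); lia. }
  set (p := (2 * 2 ^ j)%nat).
  assert (Hp : (2 <= p)%nat) by (unfold p; pose proof (pow2_gt j); lia).
  assert (H1 : (N + 1 <= N ^ p)%nat).
  { apply Nat.le_trans with (N ^ 2)%nat; [simpl; nia|apply Nat.pow_le_mono_r; lia]. }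
  assert (H2 : (N ^ p <= 2 ^ ((4 * j + 2) * p))%nat).
  { rewrite Nat.pow_mul_r; apply Nat.pow_le_mono_l; easy. }
  apply Nat.le_trans with (2 ^ S ((4 * j + 2) * p))%nat.
  - rewrite Nat.pow_succ_r'; lia.
  - apply Nat.pow_le_mono_r; [lia|].
    unfold scale; rewrite Nat.add_1_r, Nat.pow_succ_r'; fold p; nia.
Qed.

Lemma ln_pow_nat x n : 0 < x -> ln (x ^ n) = INR n * ln x.
Proof.
  intros Hx; induction n as [|n IH]; [simpl; rewrite ln_1; ring|].
  rewrite S_INR; cbn [pow]; rewrite ln_mult, IH by (try apply pow_lt; easy); ring.
Qed.

Lemma ln_le x y : 0 < x -> x <= y -> ln x <= ln y.
Proof. intros Hx [H| ->]; [left; apply ln_increasing; easy|right; easy]. Qed.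

(** ln d is at most 20 j 2^j ln 2 while ln ln d is at least j ln 2, and 20 <= 2 * 24. *)
Lemma lnln_over_ln_bound j d : (16 <= j)%nat ->
  (2 ^ scale j <= d)%nat -> (d < 2 ^ scale (S j))%nat ->
  1 / (2 * INR (2 ^ j)) <= 24 * ln (ln (INR d)) / ln (INR d).
Proof.
  intros Hj Hlo Hhi.
  assert (Hln2 : 1 / 2 < ln 2) by (pose proof ln_lt_2; lra).
  assert (HIP : forall n, INR (2 ^ n) = 2 ^ n) by (intros n; rewrite pow_INR; easy).
  apply le_INR in Hlo; apply lt_INR in Hhi; rewrite HIP in Hlo, Hhi.
  assert (H0 : 0 < 2 ^ scale j) by (apply pow_lt; lra).
  assert (Hup : ln (INR d) <= INR (scale (S j)) * ln 2).
  { rewrite <- ln_pow_nat by lra; left; apply ln_increasing; lra. }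
  assert (Hlow : INR (scale j) * ln 2 <= ln (INR d)).
  { rewrite <- ln_pow_nat by lra; apply ln_le; lra. }
  assert (H2j : 0 < 2 ^ j) by (apply pow_lt; lra).
  assert (HJ : 16 <= INR j) by (apply (le_INR 16) in Hj; simpl in Hj; lra).
  assert (Hs : 2 * 2 ^ j <= INR (scale j)).
  { rewrite <- HIP; change 2 with (INR 2) at 1; rewrite <- mult_INR; apply le_INR.
    unfold scale; rewrite Nat.add_1_r, Nat.pow_succ_r'; nia. }
  assert (HS : INR (scale (S j)) <= 20 * INR j * 2 ^ j).
  { rewrite <- HIP; replace 20 with (INR 20) by (simpl; ring).
    rewrite <- !mult_INR; apply le_INR.
    unfold scale; replace (S j + 1)%nat with (S (S j)) by lia.
    rewrite !Nat.pow_succ_r'; nia. }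
  assert (Hl1 : 2 ^ j <= ln (INR d)) by nra.
  assert (Hll : INR j * ln 2 <= ln (ln (INR d))).
  { rewrite <- ln_pow_nat by lra; apply ln_le; lra. }
  rewrite HIP.
  apply (Rmult_le_reg_r (2 * 2 ^ j * ln (INR d))); [nra|].
  replace (1 / (2 * 2 ^ j) * (2 * 2 ^ j * ln (INR d))) with (ln (INR d))
    by (field; lra).
  replace (24 * ln (ln (INR d)) / ln (INR d) * (2 * 2 ^ j * ln (INR d)))
    with (48 * 2 ^ j * ln (ln (INR d))) by (field; lra).
  apply Rle_trans with (48 * 2 ^ j * (INR j * ln 2)).
  - apply Rle_trans with (1 := Hup).
    apply Rle_trans with (20 * INR j * 2 ^ j * ln 2).
    + apply Rmult_le_compat_r; lra.
    + assert (0 <= INR j * 2 ^ j * ln 2) by (repeat apply Rmult_le_pos; lra).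
      lra.
  - apply Rmult_le_compat_l; lra.
Qed.

(** The bound on [phi] is asked from d = 3 on, where ln ln d is positive; at d = 1 the quotient
    would divide by ln 1 = 0. *)
Theorem theorem3 :
  exists c : R, c > 0 /\
    forall phi : nat -> R,
      Un_cv phi 0 ->
      (forall d : nat, (3 <= d)%nat ->
         phi d >= c * ln (ln (INR d)) / ln (INR d)) ->
      exists d0 : nat, forall d : nat, (d0 <= d)%nat ->
        fr_gt d (1/2 + phi d) (d + 1).
Proof.
  exists 24; split; [lra|]; intros phi _ Hphi.
  exists (2 ^ scale 16)%nat; intros d Hd.
  destruct (scale_between 16 d Hd) as [j [Hj [Hlo Hhi]]].
  pose proof (lnln_over_ln_bound j d Hj Hlo Hhi) as Hln.
  assert (Hd3 : (3 <= d)%nat).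
  { pose proof (pow2_gt (scale j)); pose proof (scale_gt j).
    pose proof (pow2_gt j); lia. }
  specialize (Hphi d Hd3).
  pose proof (coloring_bound j d Hj Hhi) as Hcol.
  pose proof (dimension_bound j ltac:(lia)) as Hdim.
  cbv zeta in Hcol, Hdim.
  set (q := (2 ^ (4 * j))%nat) in *; set (m := (2 ^ (3 * j - 2))%nat) in *.
  set (k := (2 ^ j)%nat) in *.
  assert (Hk : (1 <= k)%nat) by (unfold k; pose proof (pow2_gt j); lia).
  assert (Hm : (1 <= m)%nat) by (unfold m; pose proof (pow2_gt (3 * j - 2)); lia).
  assert (Hqm : (q = 4 * k * m)%nat).
  { unfold q, k, m; change 4%nat with (2 ^ 2)%nat at 2.
    rewrite <- !Nat.pow_add_r; f_equal; lia. }
  (* This is 1 - tau for tau = (2q-m)/(2q+m); as q = 4km, it is below m/q = 1/(4k). *)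
  set (e := 2 * INR m / INR (2 * q + m)).
  assert (HmR : 1 <= INR m) by (now apply (le_INR 1)).
  assert (HkR : 1 <= INR k) by (now apply (le_INR 1)).
  assert (HNR : INR (2 * q + m) = 2 * INR q + INR m)
    by (rewrite plus_INR, mult_INR; simpl; ring).
  assert (HqR : INR q = 4 * INR k * INR m)
    by (rewrite Hqm, !mult_INR; simpl; ring).
  assert (HqP : 4 <= INR q) by nra.
  assert (Hexp : S (S (2 * (k - 1))) = (2 * k)%nat) by lia.
  (* Passing k - 1 makes the tensor exponent 2k. *)
  apply (fr_gt_of_parameters (4 * j) (2 * q + m - 1) (k - 1) d (1 / 2 + phi d) (1 - e));
    fold q; replace (S (2 * q + m - 1)) with (2 * q + m)%nat by lia.
  - nia.
  - easy.
  - rewrite Hexp; lia.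
  - unfold e; rewrite HNR; field; lra.
  - apply Rle_trans with (1 / 4 + 1 / (2 * INR k)).
    + apply (radius_bound k e Hk).
      * unfold e; rewrite HNR; apply Rlt_le, Rdiv_lt_0_compat; lra.
      * unfold e; rewrite HNR.
        apply (Rmult_le_reg_r (2 * INR q + INR m)); [lra|].
        replace (4 * INR k * (2 * INR m / (2 * INR q + INR m)) * (2 * INR q + INR m))
          with (2 * INR q) by (rewrite HqR; field; nra).
        lra.
    (* The square of 1/2 + phi is at least 1/4 + phi. *)
    + assert (1 / (2 * INR k) <= phi d) by lra.
      pose proof (pow2_ge_0 (phi d)); nra.
Qed.
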